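(* Let $G$ be an abelian group, let $s,n$ be positive integers, let $K$ be a real number with $2\leq K< 2^{-36}\frac{s}{(\log n)^3}$, and let $Y\subset G$ with $|Y|=n$. Then the number of sets $J\subset Y$ with $|J|=s$ and $|J+J|\leq K|J|$ is at most \[ \exp\Big(2^9\lambda K^{1/6}s^{5/6}\sqrt{\log n}\Big)\binom{\frac{1}{2}(Ks+\beta)}{s},\] where $\beta:= \beta\big(Ks+2^6K^{7/6}s^{5/6}\sqrt{\log n}\big)$ and $\lambda:=\min\big\{\frac{K}{K-2},\log s\big\}$ (with $\frac{K}{K-2}=\infty$ when $K=2$).
   Context: $J+J=\{a+b: a,b\in J\}$. For a positive real $t$, $\beta(t)=\max\{|H|: H \text{ a subgroup of } G,\ |H|\leq t\}$ is the size of the largest subgroup of $G$ of size at most $t$. $\log$ denotes the natural logarithm; binomial coefficients $\binom{x}{s}$ with real $x$ are the generalized binomial coefficients $x(x-1)\cdots(x-s+1)/s!$. *)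

(* Defs.v *)
From HB Require Import structures.
From mathcomp Require Import all_boot all_order all_algebra.
From Stdlib Require Import Reals.

Set Implicit Arguments.
Unset Strict Implicit.
Unset Printing Implicit Defensive.

Definition fin_subgroup (G : zmodType) (H : seq G) : Prop :=
  uniq H /\ ((@GRing.zero G) \in H) /\ (forall x y, x \in H -> y \in H -> GRing.add x (GRing.opp y) \in H).

Definition is_beta (G : zmodType) (t : R) (b : nat) : Prop :=
  (exists H : seq G, fin_subgroup H /\ size H = b) /\ Rle (INR b) t /\
  (forall H : seq G, fin_subgroup H -> Rle (INR (size H)) t -> (size H <= b)%N).

Fixpoint falling (x : R) (s : nat) : R :=
  match s with
  | O => R1
  | S k => Rmult (falling x k) (Rminus x (INR k))
  end.

Definition gbinom (x : R) (s : nat) : R := Rdiv (falling x s) (INR (Stdlib.Arith.Factorial.fact s)).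

(* lambda = min{ K/(K-2), log s }, with K/(K-2) = +infinity when K = 2 *)
Definition lambda (K : R) (s : nat) : R :=
  if Req_EM_T K 2%R then ln (INR s) else Rmin (Rdiv K (Rminus K 2%R)) (ln (INR s)).

Definition sumset (G : zmodType) (J : seq G) : seq G :=
  undup [seq GRing.add x y | x <- J, y <- J].

(* Y = {Y 0, ..., Y (n-1)} (Y injective); number of J subset Y, |J| = s,
   |J+J| <= K |J|, where J = Y(A) for A a subset of 'I_n. *)
Definition count_small_doubling (G : zmodType) (n : nat) (Y : 'I_n -> G)
    (s : nat) (K : R) : nat :=
  #|[set A : {set 'I_n} | (#|A| == s) &&
      (if Rle_dec (INR (size (sumset [seq Y i | i <- enum A])))
                  (Rmult K (INR #|A|)) then true else false)]|.

(* Main.v *)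
Require Import Defs.
From HB Require Import structures.
From mathcomp Require Import all_boot all_order all_algebra finmap.
From mathcomp Require Import zify.

(** Write m = K s and eps = (K / s)^(1/6) (log n)^(1/2) < 2^-6.

    Containers.  To each J with |J + J| <= m we attach pairs (A, B) with
    A included in J + J and J included in B.  Given such a pair, let x be heavy if
    many y in B satisfy x + y notin A.  If J has fewer than q ~ sqrt m heavy
    elements, revealing them allows all other heavy elements to be deleted from B.
    Otherwise take q heavy elements X of J and choose F in J greedily so that each
    of its elements contributes many new sums to X + F; either A grows by X + F, or every y
    with many sums X + y outside A is not in J and can be deleted from B.  In all
    cases |B| - |A| drops by about eps^2 m at the cost of revealing O(sqrt m)
    elements of J, so after O(eps^-2) rounds, hence exp(O(eps s)) choices in total,
    few pairs of B x B have their sum outside A.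

    Supersaturation.  A Pollard-type strengthening of Kneser's theorem, proved with
    the Dyson transform, shows that then |B| <= (1 + 64 eps) (m + beta) / 2.

    Counting the s-subsets of the final containers B gives the bound, since
    binom((1 + d) N, s) <= exp(O(d lambda s)) binom(N, s) for N = (K s + beta) / 2. *)

Set Implicit Arguments.
Unset Strict Implicit.
Unset Printing Implicit Defensive.
Import GRing.Theory.

(** * A Pollard-Kneser inequality *)

Section PollardKneser.
Variable G : zmodType.
Implicit Types A B Z : {fset G}.
Local Open Scope fset_scope.

Definition missing_pairs Z A B : nat :=
  \sum_(a <- A) \sum_(b <- B) ((a + b)%R \notin Z).

Lemma missing_pairs_splitl (P : pred G) Z A B :
  missing_pairs Z A B = (missing_pairs Z [fset a in A | P a] B +
                         missing_pairs Z [fset a in A | ~~ P a] B)%N.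
Proof. by rewrite /missing_pairs (big_fsetID _ P). Qed.

Lemma missing_pairs_splitr (P : pred G) Z A B :
  missing_pairs Z A B = (missing_pairs Z A [fset b in B | P b] +
                         missing_pairs Z A [fset b in B | ~~ P b])%N.
Proof.
by rewrite /missing_pairs -big_split; apply: eq_bigr => a _; rewrite (big_fsetID _ P).
Qed.

(** Both sides count pairs with [a + b + e] outside [Z]. In the Dyson transform this trades a shift
    of part of [A] for a shift of part of [B]. *)
Lemma missing_pairs_shift e Z A B :
  missing_pairs Z [fset (a + e)%R | a in A] B =
  missing_pairs Z [fset (b + e)%R | b in B] A.
Proof.
have h (C D : {fset G}) : missing_pairs Z [fset (a + e)%R | a in C] D =
    \sum_(a <- C) \sum_(b <- D) ((a + e + b)%R \notin Z).
  by rewrite /missing_pairs big_imfset // => x y _ _; apply: addIr.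
rewrite !h exchange_big /=; apply: eq_bigr => b _; apply: eq_bigr => a _.
by rewrite -addrA addrC (addrC e).
Qed.

Lemma card_fset_shift e A : #|` [fset (a + e)%R | a in A]| = #|` A|.
Proof. by rewrite card_imfset //; apply: addIr. Qed.

(** For fixed [b], translation by [b] is injective, so at most [#|Z|] elements of [A] are sent into
    [Z]. *)
Lemma missing_pairs_ge Z A B :
  (#|` B| * #|` A| <= #|` B| * #|` Z| + missing_pairs Z A B)%N.
Proof.
rewrite /missing_pairs exchange_big /= card_fset_sum1 !big_distrl -big_split /=.
apply: leq_sum => b _; rewrite !mul1n.
have : (#|` [fset a in A | (a + b)%R \in Z]| <= #|` Z|)%N.
  rewrite -(card_fset_shift b); apply: fsubset_leq_card.
  by apply/fsubsetP => z /imfsetP[a /=]; rewrite !inE /= => /andP[_ h] ->.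
suff -> : \sum_(a <- A) ((a + b)%R \notin Z) = #|` [fset a in A | (a + b)%R \notin Z]|.
  have := cardfsID [fset a in A | (a + b)%R \in Z] A.
  have -> : A `&` [fset a in A | (a + b)%R \in Z] = [fset a in A | (a + b)%R \in Z].
    by apply/fsetP => x; rewrite !inE andbA andbb.
  have -> : A `\` [fset a in A | (a + b)%R \in Z] = [fset a in A | (a + b)%R \notin Z].
    by apply/fsetP => x; rewrite !inE andbC; case: (x \in A).
  by move=> <-; rewrite leq_add2r.
rewrite card_fset_sum1 big_fset /= [RHS]big_mkcond /=.
by apply: eq_bigr => a _; case: (_ \in Z).
Qed.

(* The Dyson transform at [e] replaces [A, B] by [V, U]; the pairs it discards
   are exactly those of [A1 * B1]. *)
Lemma missing_pairs_dyson e Z A B :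
  let U := [fset b in B | (b + e)%R \in A] in
  let B1 := [fset b in B | (b + e)%R \notin A] in
  let V := A `|` [fset (b + e)%R | b in B1] in
  let A1 := [fset a in A | (a - e)%R \notin B] in
  [/\ missing_pairs Z A B = (missing_pairs Z V U + missing_pairs Z A1 B1)%N,
      (#|` U| + #|` B1| = #|` B|)%N, (#|` V| = #|` A| + #|` B1|)%N &
      (#|` A1| + #|` U| = #|` A|)%N].
Proof.
move=> U B1 V A1.
have dis : A `&` [fset (b + e)%R | b in B1] = fset0.
  apply/fsetP => x; rewrite !inE; apply/negbTE/negP => /andP[xA /imfsetP[b /=]].
  by rewrite !inE /= => /andP[_ h] xE; rewrite -xE xA in h.
have A2E : [fset a in A | (a - e)%R \in B] = [fset (b + e)%R | b in U].
  apply/fsetP => x; apply/idP/imfsetP => /= [|[b /=]]; rewrite !inE /=.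
    by case/andP=> xA xB; exists (x - e)%R; rewrite ?inE ?subrK ?xA ?xB.
  by case/andP=> bB bA ->; rewrite addrK bA bB.
split.
- rewrite (missing_pairs_splitr (fun b => (b + e)%R \in A)) -/U -/B1.
  rewrite (missing_pairs_splitl (fun a => (a - e)%R \in B) _ _ B1) -/A1 A2E.
  rewrite missing_pairs_shift (missing_pairs_splitl (mem A) Z V U) addnA.
  congr (missing_pairs Z _ U + missing_pairs Z _ U + _)%N; apply/fsetP => x.
    by rewrite !inE /=; case: (x \in A); rewrite //= andbF.
  have := congr1 (fun S : {fset G} => x \in S) dis; rewrite /= !inE /=.
  by case: (x \in A) => /=; rewrite ?andbT ?andbF // => ->.
- rewrite -(cardfsID U B); congr (_ + _)%N; congr (size (enum_fset _)); apply/fsetP => x; rewrite !inE /=.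
    by case: (x \in B).
  by case: (x \in B); rewrite ?andbF //= andbT.
- by rewrite cardfsU dis cardfs0 subn0 card_fset_shift.
- rewrite -(cardfsID [fset a in A | (a - e)%R \in B] A) addnC; congr (_ + _)%N.
    have -> : A `&` [fset a in A | (a - e)%R \in B] = [fset a in A | (a - e)%R \in B].
      by apply/fsetP => x; rewrite !inE andbA andbb.
    by rewrite A2E card_fset_shift.
  by congr (size (enum_fset _)); apply/fsetP => x; rewrite !inE /=; case: (x \in A); rewrite ?andbF ?andbT.
Qed.

(** [G] may be infinite. A stabilizing element moves [a0] into [A], so filtering the differences
    [a - a0] finds the whole stabilizer. *)
Definition stabilizer_seq A a0 : seq G :=
  [seq x <- [seq (a - a0)%R | a <- A] | all (fun a => (a + x)%R \in A) A].

Lemma mem_stabilizer_seq A a0 x : a0 \in A ->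
  (x \in stabilizer_seq A a0) = all (fun a => (a + x)%R \in A) A.
Proof.
move=> a0A; rewrite mem_filter; case: allP => //= h.
by apply/mapP; exists (a0 + x)%R; rewrite ?h // addrC addKr.
Qed.

(** If [A + y] lies in the finite set [A], the two are equal, so subtracting [y] preserves [A] as
    well. *)
Lemma stabilizer_seq_subgroup A a0 : a0 \in A -> fin_subgroup (stabilizer_seq A a0).
Proof.
move=> a0A; split; first by rewrite filter_uniq // map_inj_uniq ?fset_uniq //; apply: addIr.
split; first by rewrite mem_stabilizer_seq //; apply/allP => a; rewrite addr0.
move=> x y; rewrite !mem_stabilizer_seq // => /allP hx /allP hy.
have sub : [fset (a + y)%R | a in A] `<=` A.
  by apply/fsubsetP => z /imfsetP[a /= aA ->]; apply: hy.
have /eqP eqA : [fset (a + y)%R | a in A] == A.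
  by rewrite eqEfcard sub card_fset_shift leqnn.
apply/allP => a aA; rewrite addrA.
have := hx _ aA; rewrite -{1}eqA => /imfsetP[c /= cA ->].
by rewrite addrK.
Qed.

Lemma size_stabilizer_seq A a0 : (size (stabilizer_seq A a0) <= #|` A|)%N.
Proof. by rewrite size_filter (leq_trans (count_size _ _)) // size_map. Qed.

Variables (T beta : nat).
Hypothesis subgroup_le : forall H : seq G,
  fin_subgroup H -> (size H <= T)%N -> (size H <= beta)%N.

(* If no Dyson transform strictly shrinks [B], then [B - B] stabilizes [A]. *)
Lemma dyson_stuck A B : (0 < #|` B|)%N -> (#|` B| <= #|` A|)%N ->
  (forall e b b', b \in B -> b' \in B -> (b + e)%R \in A -> (b' + e)%R \in A) ->
  (T < #|` A| \/ #|` B| <= beta)%N.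
Proof.
move=> B0 BA stuck.
have /fset0Pn[b0 b0B] : B != fset0 by rewrite -cardfs_gt0.
have /fset0Pn[a0 a0A] : A != fset0 by rewrite -cardfs_gt0 (leq_trans B0).
pose H := stabilizer_seq A a0.
have BH : (#|` B| <= size H)%N.
  rewrite -(size_map (fun b => b - b0)%R); apply: uniq_leq_size.
    by rewrite map_inj_uniq ?fset_uniq //; apply: addIr.
  move=> _ /mapP[b bB ->]; rewrite mem_stabilizer_seq //; apply/allP => a aA.
  have := stuck (a - b0)%R b0 b b0B bB; rewrite [(b0 + _)%R]addrC subrK addrCA; exact.
have [HT|HT] := leqP (size H) T; last by left; apply: leq_trans (size_stabilizer_seq A a0).
right; apply: leq_trans BH _; exact: subgroup_le (stabilizer_seq_subgroup a0A) HT.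
Qed.

(** Arithmetic of the induction when [U], of size [u], has fewer than [t] elements: [m1] and [m2]
    are the missing pairs of [V], [U] and of [A1], [B1], and the weight [t] splits as
    [u + (t - u)]. *)
Lemma dyson_arith k t u v z a b bt m1 m2 : (u < t)%N -> (t <= b)%N -> (b <= a)%N ->
  (k + t + bt <= a + b)%N -> (v + u = a + b)%N -> (u * v <= u * z + m1)%N ->
  (forall k', k' <= k -> k' + (t - u) + bt <= (a - u) + (b - u) ->
     (t - u) * k' <= (t - u) * z + m2)%N ->
  (t * k <= t * z + (m1 + m2))%N.
Proof.
move=> ut tb ba hk huv hm1 hm2.
have [h|h] := leqP (k + t + bt + u) (a + b).
  have := hm2 k (leqnn _) ltac:(lia).
  have : (u * k <= u * v)%N by apply: leq_mul; lia.
  have [t' tE] : exists t', t = (u + t')%N by exists (t - u)%N; lia.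
  by rewrite tE addKn !mulnDl; lia.
have [h'|h'] := leqP (t + bt + u) (a + b).
  (* The largest admissible [k'] falls short of [k] by at most [u]. The pairs of [V], [U] make up
     for this, since [v] is at least [k' + t]. *)
  have := hm2 (a + b - (t + bt + u))%N ltac:(lia) ltac:(lia).
  set k' := (a + b - _)%N; have kE : (k <= k' + u)%N by lia.
  have vE : (k' + t <= v)%N by lia.
  have : (u * (k' + t) <= u * v)%N by rewrite leq_mul2l vE orbT.
  have : (t * k <= t * (k' + u))%N by rewrite leq_mul2l kE orbT.
  have [t' tE] : exists t', t = (u + t')%N by exists (t - u)%N; lia.
  by rewrite tE addKn !(mulnDl, mulnDr) [(t' * u)%N]mulnC; lia.
have : (t * k <= t * u)%N by rewrite leq_mul2l; apply/orP; right; lia.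
have : (u * t <= u * v)%N by rewrite leq_mul2l; apply/orP; right; lia.
have : (u * z <= t * z)%N by rewrite leq_mul2r; apply/orP; right; lia.
by rewrite [(t * u)%N]mulnC; lia.
Qed.

(** Minimized over [Z], the right side becomes the Pollard sum of [min(t, r(z))], where [r(z)]
    counts representations of [z] as a sum. The proof is by strong induction on [#|B|], through a
    Dyson transform that strictly shrinks [B] whenever there is one. *)
Theorem pollard_kneser Z A B t k : (t <= #|` B|)%N -> (#|` B| <= #|` A|)%N ->
  (k <= T)%N -> (k + t + beta <= #|` A| + #|` B|)%N ->
  (t * k <= t * #|` Z| + missing_pairs Z A B)%N.
Proof.
move En : #|` B| => n; elim/ltn_ind: n A B t k En => n IH A B t k En tB BA kT hk.
have [->|t0] := posnP t; first by rewrite !mul0n.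
have [[e [b [b' [bB b'B bA b'A]]]]|stuck] :
  (exists e b b', [/\ b \in B, b' \in B, (b + e)%R \in A & (b' + e)%R \notin A]) \/
  (forall e b b', b \in B -> b' \in B -> (b + e)%R \in A -> (b' + e)%R \in A).
- have [h|/hasPn h] := boolP (has (fun b => has (fun b' =>
      has (fun a => (b' + (a - b))%R \notin A) A) B) B).
    left; have [b bB /hasP[b' b'B /hasP[a aA ha]]] := hasP h.
    by exists (a - b)%R, b, b'; split; rewrite // addrC subrK.
  right=> e b b' bB b'B beA; have := h b bB => /hasPn/(_ b' b'B)/hasPn/(_ _ beA).
  by rewrite addrAC subrr add0r negbK.
- have [-> cB cV cA] := missing_pairs_dyson e Z A B.
  move: cB cV cA; set U := [fset b in B | _ \in A]; set B1 := [fset b in B | _].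
  set V := A `|` _; set A1 := [fset a in A | _] => cB cV cA.
  have U0 : (0 < #|` U|)%N by rewrite cardfs_gt0; apply/fset0Pn; exists b; rewrite !inE bB.
  have B10 : (0 < #|` B1|)%N by rewrite cardfs_gt0; apply/fset0Pn; exists b'; rewrite !inE b'B.
  (* If [U] still has [t] elements, induction on [V], [U] suffices. Otherwise [V], [U] get the
     trivial bound, and induction is applied to [A1], [B1] with [t - #|U|]. *)
  have [tU|Ut] := leqP t #|` U|.
    have := IH #|` U| ltac:(lia) V U t k (erefl _) tU ltac:(lia) kT ltac:(lia).
    by lia.
  apply: (@dyson_arith k t #|` U| #|` V| _ #|` A| n beta) => //; try lia.
    exact: missing_pairs_ge.
  move=> k' k'k hk'.
  by apply: (IH #|` B1|); rewrite ?(leq_trans k'k) //; lia.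
- have : (T < #|` A| \/ n <= beta)%N by rewrite -En; apply: dyson_stuck; rewrite ?En //; lia.
  (* Either [k <= T < #|A|], or [n <= beta] and the hypothesis on [k + t + beta] leaves [k <= #|A|];
     the trivial bound then suffices. *)
  move=> hTn; have kA : (k <= #|` A|)%N by lia.
  have := missing_pairs_ge Z A B; rewrite En => hm.
  have [ZA|AZ] := leqP #|` Z| #|` A|; last first.
    have : (t * k <= t * #|` Z|)%N by rewrite leq_mul2l; apply/orP; right; lia.
    by lia.
  have : (t * (#|` A| - #|` Z|) <= n * (#|` A| - #|` Z|))%N by rewrite leq_mul2r tB orbT.
  have : (t * k <= t * #|` A|)%N by rewrite leq_mul2l kA orbT.
  have : (t * #|` Z| <= t * #|` A|)%N by rewrite leq_mul2l ZA orbT.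
  have : (n * #|` Z| <= n * #|` A|)%N by rewrite leq_mul2l ZA orbT.
  by rewrite !mulnBr; lia.
Qed.

End PollardKneser.

(** * Containers for sumsets *)

(** Such a set is the set of values of a map from ['I_q] to [option T], with [None] as padding. *)
Lemma card_small_sets (T : finType) q :
  #|[set X : {set T} | #|X| <= q]| <= #|T|.+1 ^ q.
Proof.
rewrite -card_option -[q in X in _ <= X]card_ord -card_ffun.
pose im (g : {ffun 'I_q -> option T}) : {set T} := [set x | Some x \in codom g].
rewrite -cardsT; apply: leq_trans (leq_imset_card im _); apply: subset_leq_card.
apply/subsetP => X; rewrite inE => Xq; apply/imsetP.
exists [ffun i : 'I_q => nth None [seq Some x | x <- enum X] i] => //.
apply/setP => x; rewrite inE; apply/idP/codomP => [xX|[i]]; last first.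
  rewrite ffunE; case: (ltnP i (size (enum X))) => iX.
    by rewrite (nth_map x) // => -[->]; rewrite -mem_enum mem_nth.
  by rewrite nth_default // size_map.
have lt : index x (enum X) < q by rewrite (leq_trans _ Xq) // cardE index_mem mem_enum.
by exists (Ordinal lt); rewrite ffunE (nth_map x) ?index_mem ?mem_enum // nth_index ?mem_enum.
Qed.

Lemma card_subsets_le (T : finType) (B : {set T}) s :
  #|[set J : {set T} | (J \subset B) && (#|J| == s)]| <= 'C(#|B|, s).
Proof. by rewrite -cards_draws; apply: subset_leq_card; apply/subsetP => J; rewrite !inE. Qed.

Lemma card_bigcup_le (U V : finType) (P : pred U) (E : {set V}) (S : U -> {set V}) m :
  (forall j, j \in E -> exists2 x, P x & j \in S x) ->
  (forall x, P x -> #|S x| <= m) -> #|E| <= #|P| * m.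
Proof.
move=> hE hS; have sub : E \subset \bigcup_(x | P x) S x.
  by apply/subsetP => j /hE[x Px jS]; apply/bigcupP; exists x.
apply: leq_trans (subset_leq_card sub) _; rewrite -sum_nat_const.
have : #|\bigcup_(x | P x) S x| <= \sum_(x | P x) #|S x|.
  elim/big_rec2: _ => [|i m' D _ h]; first by rewrite cards0.
  by apply: leq_trans (leq_card_setU _ _) _; rewrite leq_add2l.
by move=> /leq_trans; apply; apply: leq_sum.
Qed.

(** * The container algorithm, for an operation injective in each argument *)

Section Containers.
Variables (T : finType) (Z : choiceType) (f : T -> T -> Z).
Hypothesis f_injl : forall y, injective (f^~ y).
Hypothesis f_injr : forall x, injective (f x).
Variables (JJ : {set {set T}}) (I : {set T} -> {fset Z}) (s M : nat).
Hypothesis s_gt0 : 0 < s.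
Hypothesis JJ_card : forall J, J \in JJ -> #|J| = s.
Hypothesis I_card : forall J, J \in JJ -> #|` I J| <= M.
Hypothesis I_mem : forall (J : {set T}) x y, x \in J -> y \in J -> f x y \in I J.

Implicit Types (A : {fset Z}) (B J X F : {set T}).

Definition compatible A B : {set {set T}} :=
  [set J in JJ | (J \subset B) && (A `<=` I J)%fset].

Definition misses A X y := #|[set x in X | f x y \notin A]|.
Definition degree A B x := #|[set y in B | f x y \notin A]|.
Definition bad_pairs A B := \sum_(x in B) degree A B x.

Definition grow A X F : {fset Z} := (A `|` [fset f x y | x in X, y in F])%fset.

Lemma grow_sub A X F J : (A `<=` I J)%fset -> X \subset J -> F \subset J ->
  (grow A X F `<=` I J)%fset.
Proof.
move=> AI /subsetP XJ /subsetP FJ; rewrite fsubUset AI /=.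
by apply/fsubsetP => z /imfset2P[x /= xX [y /= yF ->]]; apply: I_mem; [apply: XJ|apply: FJ].
Qed.

(** The sums counted by [misses] are pairwise distinct by [f_injl], and none of them is in the old
    set. *)
Lemma card_misses_new A X F y : misses (grow A X F) X y + #|` grow A X F|
  <= #|` grow A X (y |: F)|.
Proof.
set A' := grow A X F; set A'' := grow _ _ _.
pose N := [fset f x y | x in [set x in X | f x y \notin A']]%fset.
have cN : #|` N| = misses A' X y.
  rewrite card_imfset /=; last exact: f_injl.
  by rewrite /misses cardE; congr size; apply: eq_enum => x; rewrite inE.
have dis : (N `&` A' = fset0)%fset.
  apply/fsetP => z; rewrite in_fsetI in_fset0; apply/negbTE/negP => /andP[/imfsetP[x /=]].
  by rewrite inE => /andP[_ h] -> zA; rewrite zA in h.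
have sub : (N `|` A' `<=` A'')%fset.
  rewrite fsubUset; apply/andP; split; apply/fsubsetP => z.
    case/imfsetP=> x /=; rewrite inE => /andP[xX _] ->; rewrite !inE; apply/orP; right.
    by apply/imfset2P; exists x => //; exists y => //; rewrite !inE eqxx.
  rewrite !inE => /orP[->//|/imfset2P[x /= xX [y' /= yF ->]]]; apply/orP; right.
  by apply/imfset2P; exists x => //; exists y' => //; rewrite !inE yF orbT.
by have := fsubset_leq_card sub; rewrite cardfsU dis cardfs0 subn0 cN.
Qed.

(** Elements of [J] are added to [F] as long as one contributes at least [c] new sums; the process
    saturates or runs for [k] steps. *)
Lemma greedy_growth A X J c k : X \subset J -> (A `<=` I J)%fset ->
  exists F, [/\ F \subset J, #|F| <= k &
    (forall y, y \in J -> misses (grow A X F) X y < c) \/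
    #|` A| + k * c <= #|` grow A X F|].
Proof.
move=> XJ AI; elim: k => [|k [F [FJ Fk [h|h]]]].
- exists set0; rewrite sub0set cards0; split=> //; right.
  by rewrite mul0n addn0 fsubset_leq_card // fsubsetUl.
- by exists F; split=> //; [exact: leqW | left].
- have [/existsP[y /andP[yJ hy]]|none] :=
    boolP [exists y, (y \in J) && (c <= misses (grow A X F) X y)].
    exists (y |: F); split.
    + by rewrite subUset sub1set yJ.
    + by rewrite (leq_trans (leq_card_setU _ _)) // cards1 add1n ltnS.
    + by right; have := card_misses_new A X F y; lia.
  exists F; split=> //; first exact: leqW.
  by left=> y yJ; move: none; rewrite negb_exists => /forallP/(_ y); rewrite yJ -ltnNge.
Qed.

Lemma degree_le A B x : degree A B x <= #|B|.
Proof. by apply: subset_leq_card; apply/subsetP => y; rewrite inE => /andP[]. Qed.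

Lemma sum_degree_misses A X B :
  \sum_(x in X) degree A B x = \sum_(y in B) misses A X y.
Proof.
rewrite /degree /misses; under eq_bigr do rewrite -sum1_card.
under [RHS]eq_bigr do rewrite -sum1_card.
rewrite (exchange_big_dep (mem B)) /=; last by move=> x y _; rewrite inE => /andP[].
apply: eq_bigr => y yB; apply: eq_bigl => x; rewrite !inE yB.
by case: (x \in X).
Qed.

(** As [f x] is injective, each new element of [A'] removes at most one [y] from the degree of
    [x]. *)
Lemma degree_grow A A' B x : (A `<=` A')%fset ->
  degree A B x <= degree A' B x + (#|` A'| - #|` A|).
Proof.
move=> AA'; rewrite -cardfsDS //.
pose D := [set y in B | f x y \in (A' `\` A)%fset].
have cD : #|D| <= #|` (A' `\` A)%fset|.
  have -> : #|D| = #|` [fset f x y | y in D]%fset|.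
    by rewrite card_imfset /= ?cardE //; apply: f_injr.
  apply: fsubset_leq_card; apply/fsubsetP => z /imfsetP[y yD ->].
  by move: yD => /=; rewrite in_set => /andP[].
apply: leq_trans (leq_add (leqnn _) cD); apply: leq_trans (leq_card_setU _ _).
apply: subset_leq_card; apply/subsetP => y; rewrite !in_set in_fsetD => /andP[-> ->].
by case: (f x y \in A').
Qed.

Lemma sum_misses_le A X B c :
  \sum_(y in B) misses A X y <=
    #|B| * c + #|B :\: [set y in B | misses A X y < c]| * #|X|.
Proof.
set B' := [set y in B | _].
have B'B : B' \subset B by apply/subsetP => y; rewrite inE => /andP[].
rewrite (big_setID B') /= (setIidPr B'B); apply: leq_add.
  apply: leq_trans (_ : \sum_(y in B') c <= _).
    by apply: leq_sum => y; rewrite inE => /andP[_ /ltnW].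
  by rewrite sum_nat_const leq_mul2r subset_leq_card ?orbT.
rewrite -sum_nat_const; apply: leq_sum => y _.
by apply: subset_leq_card; apply/subsetP => x; rewrite inE => /andP[].
Qed.

Variables (q c k u : nat).

(** Of the [3 * u], one [u] pays for the growth of [A], one for the [y] with few misses, and one
    remains as progress. *)
Definition heavy A B : {set T} := [set x in B | 3 * u <= degree A B x].

(** The step sees only the code [(X, F)], never [J], so its outcomes are no more numerous than the
    codes. An [X] with fewer than [q] elements stands for all heavy elements of [J]; otherwise it is
    a sample of them. *)
Definition container_step A B (XF : {set T} * {set T}) : {fset Z} * {set T} :=
  let: (X, F) := XF in
  if #|X| < q then (A, B :\: (heavy A B :\: X))
  else let A' := grow A X F in
       (A', if #|` A| + u <= #|` A'| then B else [set y in B | misses A' X y < c]).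

Definition codes : {set {set T} * {set T}} :=
  setX [set X : {set T} | #|X| <= q] [set F : {set T} | #|F| <= k].

Lemma card_codes : #|codes| <= #|T|.+1 ^ (q + k).
Proof. by rewrite cardsX expnD leq_mul // card_small_sets. Qed.

Hypothesis q_gt0 : 0 < q.
Hypothesis q_le : q <= 2 * u.
Hypothesis c_le : 2 * M * c <= q * u.
Hypothesis kc_ge : u <= k * c.

(** Non-heavy elements account for at most [6 * M * u] bad pairs, and each heavy one for at most
    [2 * M]. *)
Lemma card_heavy A B : #|B| <= 2 * M -> 12 * M * u <= bad_pairs A B -> 0 < M ->
  3 * u <= #|heavy A B|.
Proof.
move=> BM hbad M0; set H := heavy A B.
have HB : H \subset B by apply/subsetP => y; rewrite inE => /andP[].
have : bad_pairs A B <= #|H| * (2 * M) + (2 * M) * (3 * u).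
  rewrite /bad_pairs (big_setID H) /= (setIidPr HB); apply: leq_add.
    by rewrite -sum_nat_const; apply: leq_sum => x _; apply: leq_trans (degree_le _ _ _) BM.
  apply: leq_trans (_ : \sum_(x in B :\: H) 3 * u <= _).
    by apply: leq_sum => x; rewrite !inE => /andP[+ xB]; rewrite xB -ltnNge => /ltnW.
  rewrite sum_nat_const leq_mul2r (leq_trans _ BM) ?orbT //.
  by rewrite subset_leq_card // subsetDl.
move=> h; rewrite -(@leq_pmul2l (2 * M)) ?muln_gt0 //; move: h hbad.
by rewrite [#|H| * _]mulnC [12 * M]mulnC -[M * 12 * u]mulnA -[2 * M * (3 * u)]mulnA; lia.
Qed.

Lemma container_step_progress A B J : #|B| <= 2 * M -> 12 * M * u <= bad_pairs A B ->
  J \in compatible A B ->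
  exists2 XF, XF \in codes &
    J \in compatible (container_step A B XF).1 (container_step A B XF).2 /\
    #|(container_step A B XF).2| + #|` A| + u <= #|B| + #|` (container_step A B XF).1|.
Proof.
move=> BM hbad; rewrite inE => /andP[JJJ /andP[JB AI]].
have M0 : 0 < M.
  apply: leq_trans (I_card JJJ); have : 0 < #|J| by rewrite JJ_card.
  by case/card_gt0P=> x xJ; rewrite cardfs_gt0; apply/fset0Pn; exists (f x x); apply: I_mem.
have hH := card_heavy BM hbad M0.
have HB : heavy A B \subset B by apply/subsetP => y; rewrite inE => /andP[].
have [lt|ge] := ltnP #|J :&: heavy A B| q.
  exists (J :&: heavy A B, set0); first by rewrite !inE /= ltnW ?cards0.
  rewrite /= lt /=; split.
    rewrite inE JJJ AI andbT /=; apply/subsetP => x xJ; rewrite !inE (subsetP JB) //.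
    by rewrite xJ andNb.
  (* At least [3 * u] elements are heavy and fewer than [q <= 2 * u] of them are kept, so [B] loses
     more than [u]. *)
  have := cardsID (heavy A B :\: (J :&: heavy A B)) B.
  rewrite (setIidPr (subset_trans (subsetDl _ _) HB)).
  have := cardsID (J :&: heavy A B) (heavy A B); rewrite (setIidPr (subsetIr _ _)).
  by lia.
have [X /andP[XJH /eqP Xq]] : exists X, (X \subset J :&: heavy A B) && (#|X| == q).
  have : 0 < #|[set X : {set T} | (X \subset J :&: heavy A B) & (#|X| == q)]|.
    by rewrite cards_draws bin_gt0.
  by case/card_gt0P=> X; rewrite inE => h; exists X.
have XJ : X \subset J by apply: subset_trans XJH (subsetIl _ _).
have [F [FJ Fk hF]] := greedy_growth c k XJ AI.
exists (X, F); first by rewrite !inE /= Xq leqnn.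
rewrite /= Xq ltnn /=; set A' := grow A X F in hF *.
have AA' : (A `<=` A')%fset by apply: fsubsetUl.
have A'I : (A' `<=` I J)%fset by apply: grow_sub.
have [big|small] := leqP (#|` A| + u) #|` A'|.
  by split; [rewrite inE JJJ JB | rewrite -addnA leq_add2l].
(* A full greedy run would have added [k * c >= u] sums, so here the process has saturated. *)
case: hF => [hF|]; last first.
  by move=> /(leq_trans (leq_add (leqnn _) kc_ge)); rewrite leqNgt small.
set B' := [set y in B | _].
have B'B : B' \subset B by apply/subsetP => y; rewrite inE => /andP[].
split.
  rewrite inE JJJ A'I andbT /=; apply/subsetP => y yJ; rewrite inE (subsetP JB) //=.
  exact: hF.
(* Double counting of the pairs of [X] and [B] with sum outside [A']: by rows at least [2 * q * u],
   by columns at most [q * u] from [B'] and [q] for each deleted [y]. *)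
have h1 : q * (3 * u) <= \sum_(x in X) degree A B x.
  rewrite -Xq -sum_nat_const; apply: leq_sum => x xX.
  by have := subsetP XJH _ xX; rewrite !inE => /andP[_ /andP[]].
have h2 : \sum_(x in X) degree A B x <= \sum_(x in X) degree A' B x + q * u.
  rewrite -Xq -sum_nat_const -big_split /=; apply: leq_sum => x xX.
  by apply: leq_trans (degree_grow B x AA') _; rewrite leq_add2l leq_subLR ltnW.
have h3 := sum_misses_le A' X B c; rewrite -sum_degree_misses Xq -/B' in h3.
have h4 : #|B| * c <= q * u by apply: leq_trans c_le; rewrite leq_mul2r BM orbT.
have h5 : q * u <= q * #|B :\: B'| 
  by rewrite [q * #|_|]mulnC; move: h1 h2 h3 h4; clear; lia.
have {}h5 : u <= #|B :\: B'| by rewrite leq_pmul2l in h5.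
have := cardsID B' B; rewrite (setIidPr B'B).
by move: h5 (fsubset_leq_card AA'); clear; lia.
Qed.

Variable w : nat.
Hypothesis w_bound : forall A B, #|` A| <= M -> #|B| <= 2 * M ->
  bad_pairs A B < 12 * M * u -> #|B| <= w.

Lemma compatible_card A B J : J \in compatible A B -> #|` A| <= M.
Proof.
rewrite inE => /andP[JJJ /andP[_ AI]].
exact: leq_trans (fsubset_leq_card AI) (I_card JJJ).
Qed.

(** The potential [#|B| + M - #|A|] drops by [u] in each round. At [r = 0] it forces [B] to be
    empty, which no [J] of size [s > 0] allows. *)
Lemma card_compatible A B r : #|B| <= 2 * M -> #|B| + M <= #|` A| + r * u ->
  #|compatible A B| <= (#|T|.+1 ^ (q + k)) ^ r * 'C(w, s).
Proof.
elim: r A B => [|r IH] A B BM hr.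
  rewrite (_ : compatible A B = set0) ?cards0 //; apply/setP => J; rewrite [RHS]inE.
  apply/negP => JA; have AM := compatible_card JA.
  move: JA; rewrite inE => /andP[JJJ /andP[JB _]].
  by have := subset_leq_card JB; rewrite JJ_card //; lia.
have [->|[J0 J0c]] := set_0Vmem (compatible A B); first by rewrite cards0.
have AM := compatible_card J0c.
have [lt|ge] := ltnP (bad_pairs A B) (12 * M * u).
  apply: leq_trans (_ : 'C(w, s) <= _); last by rewrite leq_pmull // !expn_gt0.
  apply: leq_trans (leq_bin2l _ (w_bound AM BM lt)).
  apply: leq_trans (card_subsets_le B s); apply: subset_leq_card; apply/subsetP => J.
  by rewrite !inE => /andP[JJJ /andP[-> _]]; rewrite JJ_card // eqxx.
(* Only codes that make progress are kept, so that the induction hypothesis applies to every one of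
   them. *)
pose P XF := (XF \in codes) && (#|(container_step A B XF).2| + #|` A| + u <=
  #|B| + #|` (container_step A B XF).1|).
have := @card_bigcup_le _ _ P (compatible A B)
  (fun XF => compatible (container_step A B XF).1 (container_step A B XF).2)
  ((#|T|.+1 ^ (q + k)) ^ r * 'C(w, s)).
move=> /(_ _ _) H; apply: leq_trans (H _ _) _.
- move=> J /(container_step_progress BM ge)[XF XFc [Jc prog]].
  by exists XF => //; rewrite /P XFc.
- move=> XF /andP[_ prog]; apply: IH; last by rewrite mulSn in hr; lia.
  apply: leq_trans BM; apply: subset_leq_card; case: XF {prog} => X F /=.
  case: ifP => _ /=; first exact: subsetDl.
  by case: ifP => _ //; apply/subsetP => y; rewrite inE => /andP[].
rewrite expnS -mulnA leq_mul2r; apply/orP; right; apply: leq_trans card_codes.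
by apply: subset_leq_card; apply/subsetP => XF; rewrite unfold_in => /andP[].
Qed.

Hypothesis q_le_s : q <= s.
Hypothesis kq : M < k * (q %/ 2).

(* [A] has at most [M] elements, so a vertex set much larger than [M] has nearly
   full degrees; one fingerprint thus brings the container down to size [2 M]. *)
Theorem card_containers r : 3 * M <= r * u ->
  #|JJ| <= #|T|.+1 ^ ((q + k) * r.+1) * 'C(w, s).
Proof.
move=> hr.
pose A' XF := grow fset0 XF.1 XF.2.
pose B' XF := [set y | misses (A' XF) XF.1 y < q %/ 2].
pose P XF := (XF \in codes) && (#|B' XF| <= 2 * M).
have := @card_bigcup_le _ _ P JJ (fun XF => compatible (A' XF) (B' XF))
  ((#|T|.+1 ^ (q + k)) ^ r * 'C(w, s)).
move=> /(_ _ _) H; apply: leq_trans (H _ _) _.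
- move=> J JJJ.
  have [X /andP[XJ /eqP Xq]] : exists X, (X \subset J) && (#|X| == q).
    have : 0 < #|[set X : {set T} | (X \subset J) & (#|X| == q)]|.
      by rewrite cards_draws bin_gt0 JJ_card.
    by case/card_gt0P=> X; rewrite inE => h; exists X.
  have [F [FJ Fk hF]] := greedy_growth (q %/ 2) k XJ (fsub0set (I J)).
  have A'I : (grow fset0 X F `<=` I J)%fset by apply: grow_sub; rewrite ?fsub0set.
  have A'M := leq_trans (fsubset_leq_card A'I) (I_card JJJ).
  case: hF => [hF|]; last by rewrite cardfs0; lia.
  have Jc : J \in compatible (A' (X, F)) (B' (X, F)).
    by rewrite inE JJJ A'I andbT /=; apply/subsetP => y yJ; rewrite inE; apply: hF.
  exists (X, F) => //; rewrite /P !inE Xq leqnn Fk /=.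
  set B := B' (X, F).
  (* Each [x] in [X] has at least [#|B| - M] sums outside [A'], while each [y] in [B] misses fewer
     than [q / 2] times; comparing gives [#|B| <= 2 * M]. *)
  have h1 : q * #|B| <= \sum_(x in X) degree (A' (X, F)) B x + q * M.
    rewrite -Xq -!sum_nat_const -big_split /=; apply: leq_sum => x _.
    apply: leq_trans (_ : degree fset0 B x <= _).
      by apply: subset_leq_card; apply/subsetP => y; rewrite !inE andbT.
    apply: leq_trans (degree_grow B x (fsub0set (A' (X, F)))) _.
    by rewrite leq_add2l cardfs0 subn0.
  have h2 := sum_misses_le (A' (X, F)) X B (q %/ 2).
  have e0 : B :\: [set y in B | misses (A' (X, F)) X y < q %/ 2] = set0.
    by apply/setP => y; rewrite !inE; case: (_ < _).
  rewrite e0 cards0 mul0n addn0 -sum_degree_misses in h2.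
  have h3 : 2 * (#|B| * (q %/ 2)) <= #|B| * q.
    by rewrite mulnCA leq_mul2l; apply/orP; right; rewrite mulnC leq_trunc_div.
  have h4 : q * #|B| <= q * (2 * M) by rewrite mulnCA; rewrite [#|B| * q]mulnC in h3; lia.
  by rewrite leq_pmul2l in h4.
- move=> XF /andP[_ hB]; apply: card_compatible => //.
  by apply: leq_trans (leq_add hB (leqnn M)) _; lia.
rewrite -expnM mulnA mulnS [X in _ <= X * _]expnD !leq_mul2r.
apply/orP; right; apply/orP; right; apply: leq_trans card_codes.
by apply: subset_leq_card; apply/subsetP => XF; rewrite unfold_in => /andP[].
Qed.

End Containers.

(** * Sets of small doubling in an abelian group *)

Section SmallDoubling.
Variables (G : zmodType) (n : nat) (Y : 'I_n -> G).
Hypothesis Y_inj : injective Y.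

Lemma bad_pairs_missing (A : {fset G}) (B : {set 'I_n}) :
  bad_pairs (fun i j => (Y i + Y j)%R) A B =
  missing_pairs A [fset Y i | i in B]%fset [fset Y i | i in B]%fset.
Proof.
rewrite /missing_pairs big_imfset /=; last by move=> x y _ _; apply: Y_inj.
rewrite /bad_pairs -big_enum /=; apply: eq_bigr => i _.
rewrite big_imfset /=; last by move=> x y _ _; apply: Y_inj.
rewrite /degree -sum1_card big_mkcond [RHS]big_enum /= [RHS]big_mkcond /=.
by apply: eq_bigr => j _; rewrite inE; case: (j \in B); case: (_ \in A).
Qed.

(** Containers for addition on the indices of [Y], with [k = 4 * q], so that a round reveals at most
    [5 * q] elements. The pairs [t], [k] of the last hypothesis feed [pollard_kneser], which gives
    any container larger than [w] its [12 * M * u] bad pairs. *)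
Theorem card_small_doubling s M T b q c u w r :
  (forall H : seq G, fin_subgroup H -> size H <= T -> size H <= b) ->
  0 < s -> 2 < q -> q <= s -> M <= q * q -> q <= 2 * u ->
  2 * M * c <= q * u -> u <= 4 * q * c -> 3 * M <= r * u ->
  (forall y, w < y -> y <= 2 * M -> exists t k,
     [/\ t <= y, k <= T, k + t + b <= y + y & t * M + 12 * M * u <= t * k]) ->
  #|[set J : {set 'I_n} | (#|J| == s) &&
      (size (sumset [seq Y i | i <- enum J]) <= M)]| <=
    n.+1 ^ (5 * q * r.+1) * 'C(w, s).
Proof.
move=> subg s0 q2 qs Mq qu Mc uc Mr hw.
set JJ := [set J | _].
pose I (J : {set 'I_n}) := [fset (Y i + Y j)%R | i in J, j in J]%fset.
have -> : n.+1 ^ (5 * q * r.+1) = #|'I_n|.+1 ^ ((q + 4 * q) * r.+1).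
  by rewrite card_ord; congr (_ ^ (_ * _)); lia.
apply: (@card_containers _ _ (fun i j => (Y i + Y j)%R) _ _ JJ I s M _ _ _ _ q c (4 * q) u).
- by move=> y i j /addIr/Y_inj.
- by move=> x i j /addrI/Y_inj.
- by [].
- by move=> J; rewrite inE => /andP[/eqP].
- move=> J; rewrite inE => /andP[_]; apply: leq_trans.
  apply: uniq_leq_size (fset_uniq _) _ => z.
  case/imfset2P=> i /= iJ [j /= jJ ->]; rewrite mem_undup.
  by apply: allpairs_f; apply: map_f; rewrite mem_enum.
- by move=> J i j iJ jJ; apply/imfset2P; exists i => //; exists j.
- by lia.
- by [].
- by [].
- by [].
- move=> A B AM BM; apply: contraLR; rewrite -!ltnNge => wB.
  have [t [k [tB kT ktb hk]]] := hw _ wB BM.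
  have cB : #|` [fset Y i | i in B]%fset| = #|B| by rewrite card_imfset //= cardE.
  rewrite bad_pairs_missing ltnS.
  have := @pollard_kneser G T b subg A [fset Y i | i in B]%fset [fset Y i | i in B]%fset t k.
  rewrite cB => /(_ tB (leqnn _) kT ktb) h.
  rewrite -(leq_add2l (t * M)); apply: leq_trans hk _; apply: leq_trans h _.
  by rewrite leq_add2r leq_mul2l AM orbT.
- by [].
- apply: leq_ltn_trans Mq _.
  (* Despite the rounding, [q < 4 * (q %/ 2)] because [q > 2]. *)
  have : q <= (q %/ 2) * 2 + 1 by rewrite {1}(divn_eq q 2) leq_add2l -ltnS ltn_mod.
  by clear -q2; nia.
- by [].
Qed.

End SmallDoubling.

(* Imported only here because it rebinds the delimiters [%R] and [%N]. *)
From Stdlib Require Import Reals Lra.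

(** * Real estimates *)

Section RealEstimates.
Local Open Scope R_scope.

Lemma INR_addn a b : INR (a + b)%nat = INR a + INR b.
Proof. exact: plus_INR. Qed.

Lemma INR_muln a b : INR (a * b)%nat = INR a * INR b.
Proof. exact: mult_INR. Qed.

Lemma INR_expn a k : INR (expn a k) = INR a ^ k.
Proof. by elim: k => [|k IH]; rewrite ?expn0 // expnS INR_muln IH. Qed.

Lemma leq_INR a b : (a <= b)%nat <-> INR a <= INR b.
Proof. by split=> [/leP/le_INR|/INR_le/leP]. Qed.

Lemma ltn_INR a b : (a < b)%nat <-> INR a < INR b.
Proof. by split=> [/ltP/lt_INR|/INR_lt/ltP]. Qed.

Lemma nat_floor x : 0 <= x -> exists k : nat, INR k <= x < INR k + 1.
Proof.
move=> x0; have [h1 h2] := archimed x.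
have z0 : (0 < up x)%Z by apply: lt_IZR; lra.
have [k kE] := IZN (up x - 1) ltac:(lia).
by exists k; rewrite INR_IZR_INZ -kE minus_IZR; lra.
Qed.

Lemma nat_ceil x : 0 <= x -> exists k : nat, x <= INR k <= x + 1.
Proof.
move=> x0; have [k hk] := nat_floor x0; exists k.+1; rewrite S_INR; lra.
Qed.

(** * Generalized binomial coefficients *)

Lemma fact_factorial s : Factorial.fact s = s`!.
Proof. by elim: s => //= s IH; rewrite factS IH. Qed.

Lemma falling_ffact w s : falling (INR w) s = INR (w ^_ s)%nat.
Proof.
elim: s => [|s IH] //=; rewrite IH ffactnSr INR_muln.
have [sw|ws] := leqP s w; first by rewrite minus_INR //; apply/leP.
by rewrite ffact_small //= !Rmult_0_l.
Qed.

Lemma gbinom_bin w s : gbinom (INR w) s = INR 'C(w, s).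
Proof.
rewrite /gbinom falling_ffact fact_factorial -bin_ffact INR_muln; field.
by apply/not_0_INR => h; have := fact_gt0 s; rewrite h.
Qed.

Lemma falling_gt0 x s : INR s < x + 1 -> 0 < falling x s.
Proof.
elim: s => [|s IH] /=; first by lra.
rewrite -/(INR s.+1) S_INR => h; apply: Rmult_lt_0_compat; last by lra.
by apply: IH; lra.
Qed.

Lemma gbinom_gt0 x s : INR s < x + 1 -> 0 < gbinom x s.
Proof.
move=> h; apply: Rdiv_lt_0_compat; first exact: falling_gt0.
by apply: INR_fact_lt_0.
Qed.

(* [S i] dominates the partial sums of [x / (x - i)], which control the loss when
   each factor [x - i] of the binomial is replaced by [(1 + d) x - i]. *)
Lemma bin_le_gbinom (S : nat -> R) x d w s : 0 <= d -> INR s <= x ->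
  INR w <= (1 + d) * x -> S 0%nat = 0 ->
  (forall i, (i < s)%nat -> x / (x - INR i) <= S i.+1 - S i) ->
  INR 'C(w, s) <= exp (d * S s) * gbinom x s.
Proof.
move=> d0 sx wx S0 hS.
have [sw|ws] := leqP s w; last first.
  rewrite bin_small //=; apply: Rmult_le_pos; first by apply: Rlt_le; apply: exp_pos.
  by apply: Rlt_le; apply: gbinom_gt0; lra.
rewrite -gbinom_bin /gbinom /Rdiv -Rmult_assoc; apply: Rmult_le_compat_r.
  by apply: Rlt_le; apply: Rinv_0_lt_compat; apply: INR_fact_lt_0.
suff h k : (k <= s)%nat ->
    0 <= falling (INR w) k <= exp (d * S k) * falling x k by have [] := h s (leqnn s).
elim: k => [|k IH] ks; first by rewrite /= S0 Rmult_0_r exp_0; lra.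
have [h0 h1] := IH (ltnW ks).
have kw : INR k <= INR w by apply/leq_INR; lia.
have kx : INR k < x by apply: Rlt_le_trans sx; apply/ltn_INR.
have fx : 0 < falling x k by apply: falling_gt0; lra.
rewrite /=; split; first by apply: Rmult_le_pos; lra.
have step : INR w - INR k <= exp (d * (S k.+1 - S k)) * (x - INR k).
  have e1 : 1 + d * (x / (x - INR k)) <= exp (d * (S k.+1 - S k)).
    apply: Rle_trans (exp_ineq1_le _); apply: Rplus_le_compat_l.
    by apply: Rmult_le_compat_l => //; apply: hS.
  apply: Rle_trans (Rmult_le_compat_r (x - INR k) _ _ _ e1); last by lra.
  have -> : (1 + d * (x / (x - INR k))) * (x - INR k) = (1 + d) * x - INR k by field; lra.
  lra.
have -> : exp (d * S k.+1) = exp (d * S k) * exp (d * (S k.+1 - S k)).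
  by rewrite -exp_plus; congr exp; lra.
apply: Rle_trans (Rmult_le_compat _ _ _ _ h0 _ h1 step) _; first by lra.
by apply: Req_le; ring.
Qed.

Lemma exp_le_mono a c : a <= c -> exp a <= exp c.
Proof. by case=> [/exp_increasing/Rlt_le|->] //; apply: Rle_refl. Qed.

(** This is [1 + z <= exp z] at [z = ln (1 - 1 / y)]; it turns a harmonic sum into a telescoping
    one. *)
Lemma inv_le_ln_ratio y : 1 < y -> 1 / y <= ln y - ln (y - 1).
Proof.
move=> y1; have -> : ln y - ln (y - 1) = - ln (1 - 1 / y).
  have -> : 1 - 1 / y = (y - 1) / y by field; lra.
  rewrite /Rdiv ln_mult ?ln_Rinv; try lra.
  by apply: Rinv_0_lt_compat; lra.
have z0 : 0 < 1 - 1 / y.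
  have -> : 1 - 1 / y = (y - 1) / y by field; lra.
  by apply: Rdiv_lt_0_compat; lra.
have := exp_ineq1_le (ln (1 - 1 / y)); rewrite exp_ln //; lra.
Qed.

Lemma ln_le x y : 0 < x -> x <= y -> ln x <= ln y.
Proof. by move=> x0 [xy|->]; [apply: Rlt_le; apply: ln_increasing | apply: Rle_refl]. Qed.

Lemma ln_ge1 x : 3 <= x -> 1 <= ln x.
Proof.
move=> x3; rewrite -(ln_exp 1); apply: ln_le; first exact: exp_pos.
have := exp_le_3; lra.
Qed.

(** Allows the cost of the codes, which carries no [lambda], to be absorbed in the final
    exponent. *)
Lemma lambda_ge1 K s : 2 <= K -> (2 < s)%nat -> 1 <= lambda K s.
Proof.
move=> K2 s2; have ls : 1 <= ln (INR s).
  by apply: ln_ge1; have /leq_INR := s2; rewrite /=; lra.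
rewrite /lambda; case: Req_EM_T => // nK; apply: Rmin_glb => //.
have K2' : 0 < K - 2 by case: K2 => [|/esym //]; lra.
apply: (Rmult_le_reg_r (K - 2)) => //; rewrite /Rdiv Rmult_assoc Rinv_l; lra.
Qed.

Lemma bin_le_gbinom_lambda K s x d w : 2 <= K -> (2 < s)%nat -> 0 <= d ->
  (K * INR s + 1) / 2 <= x -> INR w <= (1 + d) * x ->
  INR 'C(w, s) <= exp (d * (4 * lambda K s * INR s)) * gbinom x s.
Proof.
move=> K2 s2 d0 hx wx.
have s3 : 3 <= INR s by have /leq_INR := s2; rewrite /=; lra.
have ls : 1 <= ln (INR s) by apply: ln_ge1.
have Ks : 2 * INR s <= K * INR s by apply: Rmult_le_compat_r; lra.
have sx : INR s + / 2 <= x by lra.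
have g0 : 0 < gbinom x s by apply: gbinom_gt0; lra.
suff [S [S0 hS Ss]] : exists S : nat -> R, [/\ S 0%nat = 0,
    forall i, (i < s)%nat -> x / (x - INR i) <= S i.+1 - S i &
    S s <= 4 * lambda K s * INR s].
  apply: Rle_trans (bin_le_gbinom d0 _ wx S0 hS) _; first by lra.
  apply: Rmult_le_compat_r; first by lra.
  by apply: exp_le_mono; apply: Rmult_le_compat_l.
have xi i : (i < s)%nat -> INR i + 1 <= INR s by move/leq_INR; rewrite S_INR.
have logcase : exists S : nat -> R, [/\ S 0%nat = 0,
    forall i, (i < s)%nat -> x / (x - INR i) <= S i.+1 - S i &
    S s <= 4 * ln (INR s) * INR s].
  (* The extra half keeps [y - i - 1] positive for all [i < s], so every logarithm is taken at a
     positive argument even when [K = 2]. *)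
  pose y := INR s + / 2.
  exists (fun i => y * (ln y - ln (y - INR i))); split.
  - by rewrite /= Rminus_0_r; lra.
  - move=> i /xi his; rewrite S_INR.
    have h := @inv_le_ln_ratio (y - INR i) ltac:(rewrite /y; lra).
    (* The ratio [x / (x - i)] decreases in [x], and [y <= x]. *)
    apply: (Rle_trans _ (y * (1 / (y - INR i)))).
      have a1 : 0 < x - INR i by lra.
      have a2 : 0 < y - INR i by rewrite /y; lra.
      have -> : x / (x - INR i) = 1 + INR i * / (x - INR i) by field; lra.
      have -> : y * (1 / (y - INR i)) = 1 + INR i * / (y - INR i) by field; lra.
      apply: Rplus_le_compat_l; apply: Rmult_le_compat_l; first exact: pos_INR.
      by apply: Rinv_le_contravar; rewrite // /y; lra.
    have -> : y * (ln y - ln (y - (INR i + 1))) - y * (ln y - ln (y - INR i)) =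
      y * (ln (y - INR i) - ln (y - INR i - 1)).
      have -> : y - (INR i + 1) = y - INR i - 1 by lra.
      by ring.
    by apply: Rmult_le_compat_l h; rewrite /y; lra.
  - have -> : y - INR s = / 2 by rewrite /y; lra.
    have -> : ln y - ln (/ 2) = ln (2 * y).
      have y0 : 0 < y by rewrite /y; lra.
      rewrite ln_mult ?ln_Rinv; lra.
    (* Here [2 * y = 2 * s + 1], which is at most [s * s] once [s >= 3]. *)
    have : ln (2 * y) <= 2 * ln (INR s).
      have -> : 2 * ln (INR s) = ln (INR s * INR s) by rewrite ln_mult; lra.
      by apply: ln_le; rewrite /y; nra.
    rewrite /y; nra.
rewrite /lambda; case: Req_EM_T => // nK.
have K2' : 0 < K - 2 by case: K2 => [|/esym //]; lra.
rewrite /Rmin; case: Rle_dec => _ //.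
have L0 : 0 < K / (K - 2) by apply: Rdiv_lt_0_compat; lra.
(* Since [i < s <= 2 * x / K], every ratio [x / (x - i)] is at most [K / (K - 2)]. *)
exists (fun i => INR i * (K / (K - 2))); split; first by rewrite /= Rmult_0_l.
- move=> i /xi his; rewrite S_INR.
  have a1 : 0 < x - INR i by lra.
  have -> : (INR i + 1) * (K / (K - 2)) - INR i * (K / (K - 2)) = K / (K - 2) by ring.
  apply: (Rmult_le_reg_r ((K - 2) * (x - INR i))); first exact: Rmult_lt_0_compat.
  have -> : x / (x - INR i) * ((K - 2) * (x - INR i)) = x * (K - 2) by field; lra.
  have -> : K / (K - 2) * ((K - 2) * (x - INR i)) = K * (x - INR i) by field; lra.
  have : K * INR i <= K * INR s by apply: Rmult_le_compat_l; lra.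
  lra.
- by rewrite [is_left _]/=; move: L0; move: (K / (K - 2)) => l l0; nra.
Qed.

(* The witnesses are [t ~ 32 x m] and [k ~ (1 + 32 x) m]. *)
Lemma supersaturation_parameters m x (M T b u w : nat) :
  0 < x -> x <= / 64 -> 0 < m -> 1 <= x * m -> INR M <= m ->
  m + 64 * x * m < INR T + 1 -> INR u <= 32 * (x * x * m) ->
  (1 + 64 * x) * ((m + INR b) / 2) < INR w + 1 ->
  forall y, (w < y)%nat -> (y <= 2 * M)%nat -> exists t k : nat,
     [/\ t <= y, k <= T, k + t + b <= y + y & t * M + 12 * M * u <= t * k]%nat.
Proof.
move=> x0 x64 m0 xm1 Mm hT hu hw y wy _.
have b0 := pos_INR b.
have yw : INR w + 1 <= INR y by have /leq_INR := wy; rewrite S_INR.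
have [t [t1 t2]] : exists t : nat, INR t <= 32 * (x * m) < INR t + 1 by apply: nat_floor; lra.
have [k [k1 k2]] : exists k : nat, INR k <= m + 32 * (x * m) < INR k + 1.
  by apply: nat_floor; lra.
have xb : 0 <= x * INR b by apply: Rmult_le_pos; lra.
have xm : 64 * (x * m) <= m by nra.
exists t, k; split.
- by apply/leq_INR; lra.
- suff : INR k < INR T.+1 by move/ltn_INR.
  by rewrite S_INR; lra.
(* [k + t] is at most [(1 + 64 x) m], while [2 y] exceeds [(1 + 64 x) (m + b)]. *)
- by apply/leq_INR; rewrite !INR_addn; lra.
apply/leq_INR; rewrite INR_addn !INR_muln.
have -> : INR 12 = 12 by rewrite INR_IZR_INZ.
have M0 := pos_INR M.
(* Rounding costs at most [1 <= x m], hence 31 in place of 32. It suffices that [31 * 31] exceeds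
   [12 * 32]. *)
have h1 : 31 * (x * m) <= INR t by lra.
have h2 : 31 * (x * m) <= INR k - INR M by lra.
have h3 : (31 * (x * m)) * (31 * (x * m)) <= INR t * (INR k - INR M).
  by apply: Rmult_le_compat; lra.
have h4 : INR M * INR u <= m * (32 * (x * x * m)).
  by apply: Rmult_le_compat => //; apply: pos_INR.
have h5 : 0 <= x * m * (x * m) by nra.
nra.
Qed.

(* The witnesses are [q ~ sqrt m], [u ~ 32 x^2 m], [c ~ q u / (2 M)] and [r ~ 3 M / u]. *)
Lemma container_parameters m x rho (s M T b : nat) :
  0 < x -> x <= / 64 -> 3 <= rho -> rho * rho = m -> 1 <= x * x * rho ->
  rho + 1 <= INR s -> INR M <= m -> m < INR M + 1 -> m + 64 * x * m < INR T + 1 ->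
  exists q c u w r : nat,
    [/\ [/\ 2 < q, q <= s, M <= q * q & q <= 2 * u]%nat,
        [/\ 2 * M * c <= q * u, u <= 4 * q * c & 3 * M <= r * u]%nat,
        forall y, (w < y)%nat -> (y <= 2 * M)%nat -> exists t k : nat,
          [/\ t <= y, k <= T, k + t + b <= y + y & t * M + 12 * M * u <= t * k]%nat,
        INR w <= (1 + 64 * x) * ((m + INR b) / 2) &
        INR (5 * q * r.+1)%nat * (x * x) <= 2 * rho].
Proof.
move=> x0 x64 rho3 rhom xrho rhos Mm mM hT.
have m9 : 9 <= m by nra.
have P1 : rho <= x * x * m by rewrite -rhom; nra.
have xm1 : 1 <= x * m by nra.
have [u [u1 u2]] : exists u : nat, INR u <= 32 * (x * x * m) < INR u + 1.
  by apply: nat_floor; lra.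
have b0 := pos_INR b.
have [w [w1 w2]] : exists w : nat, INR w <= (1 + 64 * x) * ((m + INR b) / 2) < INR w + 1.
  by apply: nat_floor; apply: Rmult_le_pos; lra.
have [q [q1 q2]] : exists q : nat, rho <= INR q <= rho + 1 by apply: nat_ceil; lra.
have u31 : 31 * (x * x * m) <= INR u by lra.
have u0 : 0 < INR u by lra.
have M0 : 8 <= INR M by lra.
have [r [r1 r2]] : exists r : nat, 3 * INR M / INR u <= INR r <= 3 * INR M / INR u + 1.
  by apply: nat_ceil; apply: Rlt_le; apply: Rdiv_lt_0_compat; lra.
have q2' : (2 < q)%nat by apply/ltn_INR; rewrite /=; lra.
have Mq : (M <= q * q)%nat by apply/leq_INR; rewrite INR_muln; nra.
have Mn : (0 < M)%nat by apply/ltn_INR; rewrite /=; lra.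
(* Makes the quotient [c] positive, so that [c + 1 <= 2 * c] below. *)
have Mqu : (2 * M <= q * u)%nat by apply/leq_INR; rewrite !INR_muln /=; nra.
exists q, ((q * u) %/ (2 * M))%nat, u, w, r; split => //.
- split => //; apply/leq_INR; rewrite ?INR_muln /=; lra.
- split.
  + by rewrite mulnC leq_trunc_div.
  + set c := (_ %/ _)%nat.
    have c1 : (0 < c)%nat by rewrite divn_gt0 // muln_gt0.
    have : (q * u < c.+1 * (2 * M))%nat by rewrite ltn_ceil // muln_gt0.
    move=> h; have h' : (q * u <= q * (4 * q * c))%nat.
      apply: leq_trans (ltnW h) _; rewrite (_ : q * (4 * q * c) = (q * q) * (4 * c))%nat; last by lia.
      apply: leq_trans (_ : M * (4 * c) <= _)%nat; last by rewrite leq_mul2r Mq orbT.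
      rewrite mulnA [(M * _)%nat]mulnC leq_mul2r; apply/orP; right.
      by move: c1; clear; lia.
    by rewrite -(@leq_pmul2l q) // (leq_trans _ q2').
  + apply/leq_INR; rewrite !INR_muln.
    have -> : INR 3 = 3 by rewrite /=; lra.
    have -> : 3 * INR M = 3 * INR M / INR u * INR u by field; lra.
    by apply: Rmult_le_compat_r; lra.
- by apply: (@supersaturation_parameters m x) => //; lra.
rewrite !INR_muln (S_INR r).
have -> : INR 5 = 5 by rewrite /=; lra.
(* [r + 1] is at most [3 M / u + 2], and [u >= 31 x^2 m]; the product is at most [3/31 + 2/64^2]. *)
have hr : (INR r + 1) * (x * x) <= / 5.
  have : 3 * INR M / INR u * (x * x) <= 3 / 31.
    apply: (Rmult_le_reg_r (INR u)) => //.
    have -> : 3 * INR M / INR u * (x * x) * INR u = 3 * INR M * (x * x) by field; lra.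
    have : INR M * (x * x) <= m * (x * x) by apply: Rmult_le_compat_r; nra.
    lra.
  have : x * x <= / 64 * / 64 by apply: Rmult_le_compat; lra.
  have : INR r * (x * x) <= (3 * INR M / INR u + 1) * (x * x).
    by apply: Rmult_le_compat_r; nra.
  lra.
have : INR q * ((INR r + 1) * (x * x)) <= (2 * rho) * / 5.
  apply: Rmult_le_compat; try lra.
  by apply: Rmult_le_pos; [have := pos_INR r; lra | nra].
lra.
Qed.

(** * Size of the error parameter *)

Lemma Rpower_div6_pow6 y a : 0 < y -> Rpower y (a / 6) ^ 6 = Rpower y a.
Proof.
move=> y0; rewrite -Rpower_pow ?Rpower_mult; last exact: exp_pos.
by congr Rpower; rewrite /=; lra.
Qed.

(* [x] stands for [(K / s) ^ (1/6) * sqrt l], where [l = log n]. *)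
Lemma epsilon_bounds K x rho s l : 2 <= K -> 0 < x -> 1 <= s -> 1 <= l -> 0 < rho ->
  rho * rho = K * s -> x ^ 6 * s = K * l ^ 3 -> K * 2 ^ 36 * l ^ 3 < s ->
  [/\ x <= / 64, 1 <= x * x * rho & rho * l <= x ^ 3 * s].
Proof.
move=> K2 x0 s1 l1 rho0 hrho hx hK.
have l3 : 1 <= l ^ 3 by apply: pow_R1_Rle.
have rho1 : 1 <= rho by nra.
split.
(* The constant [2 ^ 36] of the hypothesis is [64 ^ 6]. *)
- have [//|xgt] := Rle_lt_dec x (/ 64).
  have : (/ 64) ^ 6 <= x ^ 6 by apply: pow_incr; lra.
  nra.
- have [//|lt] := Rle_lt_dec 1 (x * x * rho).
  (* Cubing brings in [x ^ 6], and the cube equals [K^2 l^3 rho >= 1]. *)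
  have lt3 : (x * x * rho) ^ 3 < 1 ^ 3.
    have p0 : 0 < x * x * rho by apply: Rmult_lt_0_compat; nra.
    move: (x * x * rho) p0 lt => p p0 lt; have : p * p < 1 by nra.
    by rewrite /=; nra.
  have e : (x * x * rho) ^ 3 = K * K * l ^ 3 * rho.
    have -> : (x * x * rho) ^ 3 = x ^ 6 * (rho * rho) * rho by ring.
    rewrite hrho; have -> : x ^ 6 * (K * s) * rho = x ^ 6 * s * K * rho by ring.
    by rewrite hx; ring.
  have : 1 * 1 * 1 * 1 <= K * K * l ^ 3 * rho.
    by repeat (apply: Rmult_le_compat; try lra); nra.
  lra.
- apply: Rsqr_incr_0_var; last by apply: Rmult_le_pos; [apply: pow_le; lra | lra].
  rewrite /Rsqr.
  have -> : x ^ 3 * s * (x ^ 3 * s) = x ^ 6 * s * s by ring.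
  have -> : rho * l * (rho * l) = rho * rho * l ^ 2 by ring.
  rewrite hx hrho; have -> : K * l ^ 3 * s = K * s * l ^ 2 * l by ring.
  have : 0 <= K * s * l ^ 2.
    by apply: Rmult_le_pos; [nra | apply: pow_le; lra].
  nra.
Qed.

Lemma card_sets_gt (n s : nat) (P : pred {set 'I_n}) : (n < s)%nat ->
  #|[set A : {set 'I_n} | (#|A| == s) && P A]| = 0%nat.
Proof.
move=> ns; apply/eqP; rewrite cards_eq0 -subset0; apply/subsetP => A; rewrite !inE.
by case/andP=> /eqP As _; have := max_card (mem A); rewrite card_ord As leqNgt ns.
Qed.

End RealEstimates.

(** * Combining the container count with the binomial estimate *)

Theorem theorem4p1 (G : zmodType) (s n : nat) (K : R) (Y : 'I_n -> G) (b : nat) :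
  (0 < s)%N -> (0 < n)%N ->
  Rle 2%R K ->
  Rlt (K * 2 ^ 36 * (ln (INR n)) ^ 3)%R (INR s) ->
  injective Y ->
  is_beta G (K * INR s + 2 ^ 6 * Rpower K (7 / 6) * Rpower (INR s) (5 / 6)
             * sqrt (ln (INR n)))%R b ->
  Rle (INR (count_small_doubling Y s K))
      (exp (2 ^ 9 * lambda K s * Rpower K (1 / 6) * Rpower (INR s) (5 / 6)
             * sqrt (ln (INR n))) * gbinom ((K * INR s + INR b) / 2) s)%R.
Proof.
move=> s0 n0 K2 hK Yinj hb.
(* A subgroup contains 0. This supplies the extra half needed in [bin_le_gbinom_lambda]. *)
have b1 : (1 <= INR b)%R.
  have [[H [[_ [H0 _]] <-]] _] := hb.
  have : (0 < size H)%nat by case: H H0.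
  by move/leq_INR.
have s1 : (1 <= INR s)%R by apply/(leq_INR 1).
have Ks : (2 * INR s <= K * INR s)%R by apply: Rmult_le_compat_r; lra.
have gb : (0 < gbinom ((K * INR s + INR b) / 2) s)%R by apply: gbinom_gt0; lra.
rewrite /count_small_doubling.
have [ns|sn] := ltnP n s.
  rewrite card_sets_gt //=; apply: Rmult_le_pos; apply: Rlt_le => //; exact: exp_pos.
(* For [n = 1] the logarithm vanishes and the bound is [(K + b) / 2 >= 1], with at most one set to
   count. *)
have [n1|n2] := leqP n 1.
  have sE : s = 1%nat by lia.
  have nE : n = 1%nat by lia.
  subst s n; rewrite ln_1 sqrt_0 !Rmult_0_r exp_0 Rmult_1_l.
  apply: (Rle_trans _ (INR 'C(1, 1))).
    apply/leq_INR; rewrite -[X in 'C(X, _)]card_ord -card_draws; apply: subset_leq_card.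
    by apply/subsetP => A; rewrite !inE => /andP[].
  by rewrite bin1 /gbinom /=; lra.
set l := ln (INR n) in hK hb *.
(* A bootstrap: [l > 1/2] already forces [s >= 16], and then [n >= s] gives [l >= 1]. *)
have hl : (/ 2 < l)%R.
  apply: Rlt_le_trans ln_lt_2 _; apply: ln_le; first by lra.
  exact/(leq_INR 2).
have l3 : (/ 8 <= l ^ 3)%R.
  have -> : (/ 8 = (/ 2) ^ 3)%R by rewrite /=; lra.
  by apply: pow_incr; lra.
have s16 : (16 <= INR s)%R by nra.
have sn' : (INR s <= INR n)%R by apply/leq_INR.
have l1 : (1 <= l)%R by apply: ln_ge1; lra.
have s2 : (2 < s)%nat by apply/ltn_INR; rewrite /=; lra.
pose x := (Rpower K (1 / 6) * Rpower (INR s) (-1 / 6) * sqrt l)%R.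
have x0 : (0 < x)%R.
  apply: Rmult_lt_0_compat; last by apply: sqrt_lt_R0; lra.
  by apply: Rmult_lt_0_compat; apply: exp_pos.
have s56 : (Rpower (INR s) (5 / 6) = INR s * Rpower (INR s) (-1 / 6))%R.
  rewrite -{2}(Rpower_1 (INR s)) -?Rpower_plus; last by lra.
  by congr Rpower; lra.
have K76 : (Rpower K (7 / 6) = K * Rpower K (1 / 6))%R.
  rewrite -{2}(Rpower_1 K) -?Rpower_plus; last by lra.
  by congr Rpower; lra.
have -> : (2 ^ 9 * lambda K s * Rpower K (1 / 6) * Rpower (INR s) (5 / 6) * sqrt l =
           512 * lambda K s * (x * INR s))%R by rewrite s56 /x; ring.
have tE : (K * INR s + 2 ^ 6 * Rpower K (7 / 6) * Rpower (INR s) (5 / 6) * sqrt l =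
          K * INR s + 64 * x * (K * INR s))%R by rewrite s56 K76 /x; ring.
rewrite {}tE in hb.
have x6 : (x ^ 6 * INR s = K * l ^ 3)%R.
  rewrite /x !Rpow_mult_distr !Rpower_div6_pow6 ?Rpower_1; try lra.
  have -> : (sqrt l ^ 6 = (sqrt l * sqrt l) ^ 3)%R by ring.
  rewrite sqrt_sqrt ?Rpower_Ropp ?Rpower_1; try lra.
  by field; lra.
pose rho := sqrt (K * INR s).
have rhoE : (rho * rho = K * INR s)%R by apply: sqrt_sqrt; lra.
have rho0 : (0 < rho)%R by apply: sqrt_lt_R0; lra.
have [x64 xrho rhol] := epsilon_bounds K2 x0 s1 l1 rho0 rhoE x6 hK.
have rho3 : (3 <= rho)%R by nra.
have rhos : (rho + 1 <= INR s)%R.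
  have : (K * 4 <= INR s)%R by nra.
  nra.
have [M [M1 M2]] := nat_floor (x := (K * INR s)%R) ltac:(lra).
(* Subgroup sizes and sumset sizes are integers, so the real thresholds can be replaced by their
   floors [T] and [M]. *)
have [T [T1 T2]] : exists T : nat,
    (INR T <= K * INR s + 64 * x * (K * INR s) < INR T + 1)%R.
  by apply: nat_floor; nra.
have [q [c [u [w [r [[q2 qs Mq qu] [Mc uc Mr] hw wN hcost]]]]]] :=
  @container_parameters _ x rho s M T b x0 x64 rho3 rhoE xrho rhos M1 M2 T2.
have subg (H : seq G) : fin_subgroup H -> (size H <= T)%nat -> (size H <= b)%nat.
  by move=> Hs /leq_INR HT; have [_ [_]] := hb; apply => //; lra.
have := card_small_doubling Yinj subg s0 q2 qs Mq qu Mc uc Mr hw.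
set C1 := #|_|; set C2 := #|_| => hC.
have C21 : (C2 <= C1)%nat.
  apply: subset_leq_card; apply/subsetP => A; rewrite !inE => /andP[/eqP -> ].
  rewrite eqxx /=; case: Rle_dec => // h _.
  have : (INR (size (sumset [seq Y i | i <- enum A])) < INR M.+1)%R.
    by rewrite S_INR; apply: Rle_lt_trans h M2.
  by move/ltn_INR.
apply: (Rle_trans _ (INR (expn n.+1 (5 * q * r.+1) * 'C(w, s))%nat)).
  by apply/leq_INR; apply: leq_trans C21 hC.
rewrite INR_muln INR_expn.
have lam := lambda_ge1 K2 s2.
have hbin := @bin_le_gbinom_lambda K s ((K * INR s + INR b) / 2)%R (64 * x)%R w K2 s2
  ltac:(lra) ltac:(lra) wN.
(* With [e] the exponent, [e x^2 <= 2 rho], [rho l <= x^3 s] and [ln (n + 1) <= 2 l]; the claim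
   follows on dividing by [x^2]. *)
have hpow : (INR n.+1 ^ (5 * q * r.+1) <= exp (4 * (x * INR s)))%R.
  have n1p : (0 < INR n.+1)%R by apply: lt_0_INR; lia.
  rewrite -[X in (X ^ _)%R](exp_ln _ n1p) -Rpower_pow; last exact: exp_pos.
  rewrite /Rpower ln_exp; apply: exp_le_mono.
  have ln1 : (ln (INR n.+1) <= 2 * l)%R.
    have -> : (2 * l = ln (INR n * INR n))%R by rewrite ln_mult /l; lra.
    by apply: ln_le => //; rewrite S_INR; nra.
  set e := INR (5 * q * r.+1) in hcost *.
  have e0 : (0 <= e)%R by apply: pos_INR.
  apply: (Rle_trans _ (e * (2 * l)))%R; first exact: Rmult_le_compat_l.
  apply: (Rmult_le_reg_r (x * x)); first by nra.
  have -> : (4 * (x * INR s) * (x * x) = 4 * (x ^ 3 * INR s))%R by ring.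
  have -> : (e * (2 * l) * (x * x) = e * (x * x) * (2 * l))%R by ring.
  apply: (Rle_trans _ (2 * rho * (2 * l)))%R; last by lra.
  by apply: Rmult_le_compat_r; lra.
apply: (Rle_trans _ (exp (4 * (x * INR s)) *
   (exp (64 * x * (4 * lambda K s * INR s)) * gbinom ((K * INR s + INR b) / 2) s)))%R.
  by apply: Rmult_le_compat => //; [apply: pow_le; apply: pos_INR | apply: pos_INR].
rewrite -Rmult_assoc -exp_plus; apply: Rmult_le_compat_r; first by lra.
apply: exp_le_mono.
(* The exponents add up to [(4 + 256 lambda) x s], at most [512 lambda x s] because
   [lambda >= 1]. *)
have xs : (0 < x * INR s)%R by apply: Rmult_lt_0_compat; lra.
nra.
Qed.
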